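(* A mixed proof for the language At least one selected (ALOS) requires $\Omega(n\log n)$ bits. That is, for every correct mixed nondeterministic scheme for ALOS that uses, on $n$-node instances of the language, local certificates of $f(n)$ bits per node and a global certificate of $g(n)$ bits, we have $n\cdot f(n)+g(n)=\Omega(n\log n)$.
   Context: A network is a finite connected simple graph without loops; $n$ is its number of nodes. Nodes carry pairwise distinct identifiers, positive integers in a range polynomial in $n$ (at most $n^{\kappa}$ for a fixed constant $\kappa\ge 1$). Nodes may carry inputs. A distributed language is a set of graphs with inputs (membership does not depend on identifiers). A mixed nondeterministic scheme for a language $\mathcal L$ consists of a verifier of constant radius $r\ge 1$ (constant with respect to $n$). The prover provides one global certificate string seen by all nodes and a local certificate string to each node. Each node $v$ sees its $r$-neighborhood (the structure of the graph, the identifiers, inputs and local certificates of the nodes at distance at most $r$ from $v$) and the global certificate, and outputs accept or reject. The verifier is uniform: it does not know $n$. The scheme is correct if: for every $n$-node labeled graph in $\mathcal L$ (with identifiers in the range above) there exist local certificates of $f(n)$ bits and a global certificate of $g(n)$ bits making all nodes accept; and for every labeled graph not in $\mathcal L$, for every choice of certificates, at least one node rejects. Because the verifier is uniform and receives no guarantee relating the number of nodes to the identifiers or the certificate lengths, the latter condition is required for all certificate lengths and all assignments of distinct positive integers as identifiers. The size of the mixed proof is $n f(n)+g(n)$. The constant in $\Omega$ may depend on the scheme (in particular on $r$). ALOS: each node has an input label; a node is selected if its label is non-zero; a labeled graph is in ALOS if and only if at least one node is selected. *)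

(* Defs.v *)
From HB Require Import structures.
From mathcomp Require Import all_boot all_order all_algebra.
From mathcomp Require Import finmap.
From mathcomp Require Import reals topology normedtype landau exp.
Set Implicit Arguments.
Unset Strict Implicit.
Unset Printing Implicit Defensive.

Import Order.TTheory GRing.Theory Num.Theory.
Import numFieldNormedType.Exports.

Local Open Scope fset_scope.
Local Open Scope ring_scope.

(* Without the nonemptiness field the graph with no node would be a network. On
   it no node can ever reject, so no scheme could be correct for a language not
   containing it. *)
Record network := Network {
  node :> finType;
  adj : rel node;
  adj_sym : symmetric adj;
  adj_irrefl : irreflexive adj;
  network_connected : forall u v : node, connect adj u v;
  network_nonempty : (0 < #|node|)%N
}.

Record labeled_graph := LabeledGraph {
  graph :> network;
  input : graph -> nat
}.

Definition distributed_language := labeled_graph -> Prop.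

Definition selected (G : labeled_graph) (v : G) : bool := input v != 0%N.

Definition ALOS : distributed_language :=
  fun G => exists v : G, selected v.

Definition identifier_assignment (G : network) (id : G -> nat) : Prop :=
  injective id /\ forall v, (0 < id v)%N.

Definition identifiers_in_range (R : realType) (kappa : R) (G : network)
    (id : G -> nat) : Prop :=
  forall v, (id v)%:R <= #|G|%:R `^ kappa.

Definition dist_le (G : network) (r : nat) (v w : G) : bool :=
  [exists k : 'I_r.+1, exists p : k.-tuple G,
     path (@adj G) v p && (last v p == w)].

(* As identifiers are pairwise distinct, the r-neighborhood of a node is coded
   canonically by naming every node by its identifier: two nodes (possibly of
   different graphs) have equal views if and only if their r-neighborhoods are
   isomorphic by a map preserving the center, the edges, the identifiers, the
   inputs and the certificates. *)
Record view := View {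
  view_center : nat;
  view_nodes : {fset nat * nat * bitseq};
  view_edges : {fset nat * nat}
}.

(* The edges seen are those of the subgraph induced by the nodes at distance at
   most r, including the edges between two nodes at distance exactly r. *)
Definition local_view (r : nat) (G : labeled_graph) (id : G -> nat)
    (cert : G -> bitseq) (v : G) : view :=
  View (id v)
    [fset (id w, input w, cert w) | w in [pred w : G | dist_le r v w]]
    [fset (id e.1, id e.2) | e in [pred e : G * G |
       [&& dist_le r v e.1, dist_le r v e.2 & adj e.1 e.2]]].

(* The second argument is the global certificate. *)
Definition verifier := view -> bitseq -> bool.

Definition accepts (r : nat) (A : verifier) (G : labeled_graph) (id : G -> nat)
    (cert : G -> bitseq) (gcert : bitseq) (v : G) : bool :=
  A (local_view r id cert v) gcert.

(* Certificates of an n-node instance of L have at most f n, resp. g n, bits;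
   this includes the schemes whose certificates have exactly these lengths. *)
Definition complete_scheme (R : realType) (kappa : R) (L : distributed_language)
    (r : nat) (A : verifier) (f g : nat -> nat) : Prop :=
  forall (G : labeled_graph) (id : G -> nat),
    L G -> identifier_assignment id -> identifiers_in_range kappa id ->
    exists (cert : G -> bitseq) (gcert : bitseq),
      [/\ forall v, (size (cert v) <= f #|G|)%N,
          (size gcert <= g #|G|)%N &
          forall v, accepts r A id cert gcert v].

(* Neither the certificate lengths nor the range of the identifiers are
   restricted here. *)
Definition sound_scheme (L : distributed_language) (r : nat) (A : verifier) :
    Prop :=
  forall (G : labeled_graph) (id : G -> nat),
    ~ L G -> identifier_assignment id ->
    forall (cert : G -> bitseq) (gcert : bitseq),
      exists v, ~~ accepts r A id cert gcert v.

Definition correct_scheme (R : realType) (kappa : R) (L : distributed_language)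
    (r : nat) (A : verifier) (f g : nat -> nat) : Prop :=
  complete_scheme kappa L r A f g /\ sound_scheme L r A.

Definition mixed_proof_size (f g : nat -> nat) (n : nat) : nat :=
  (n * f n + g n)%N.

(* Main.v *)
(** Put on a cycle of length [n] blocks of [2 r + 1] consecutive identifiers, in
    an arbitrary order, followed by a tail of selected nodes. A view of an
    unselected node away from the tail lies in two consecutive blocks. If two
    orders [p] and [s] are accepted with the same global certificate, and with
    the same local certificates when these are indexed by identifiers, then
    [p = s]: otherwise some block follows another one in [s] but precedes it in
    [p], and closing the segment of [p] between these two blocks gives a cycle
    without selected node, all of whose views are accepted. Hence the
    certificates determine the order, so that about [(n / (2 r + 1))!] is at most
    [2 ^ (n (f n + 1) + g n + 1)]. *)

Require Import Defs.
From HB Require Import structures.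
From mathcomp Require Import finmap fingroup perm zify ring.
From mathcomp Require Import all_boot all_order all_algebra.
From mathcomp Require Import classical_sets reals topology normedtype landau exp.
Import Order.TTheory GRing.Theory Num.Theory.
Import numFieldNormedType.Exports.
Local Open Scope classical_set_scope.
Local Open Scope ring_scope.

(** * Balls and views on a cycle *)

Lemma dist_leP (G : network) (r : nat) (v w : G) :
  reflect (exists p, [/\ (size p <= r)%N, path (@adj G) v p & last v p = w])
          (dist_le r v w).
Proof.
apply: (iffP existsP) => [[k /existsP[p /andP[pth /eqP lst]]]|[p [sz pth lst]]].
  by exists p; rewrite size_tuple -ltnS ltn_ord.
exists (Ordinal (sz : (size p < r.+1)%N)); apply/existsP.
by exists (in_tuple p); rewrite /= pth lst eqxx.
Qed.

Definition cycle_adj {n : nat} : rel 'I_n.+2 :=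
  [rel u v | (v == u + 1) || (u == v + 1)].

Lemma cycle_adj_sym (n : nat) : symmetric (@cycle_adj n).
Proof. by move=> u v; rewrite /cycle_adj /= orbC. Qed.

Lemma cycle_adj_irrefl (n : nat) : irreflexive (@cycle_adj n).
Proof.
move=> u; rewrite /cycle_adj /= orbb -[X in X == _]addr0 (inj_eq (addrI _)).
by rewrite eq_sym oner_eq0.
Qed.

Lemma cycle_connected (n : nat) (u v : 'I_n.+2) : connect (@cycle_adj n) u v.
Proof.
have H k : connect (@cycle_adj n) u (u + k%:R).
  elim: k => [|k IH]; first by rewrite addr0 connect0.
  apply: connect_trans IH (connect1 _).
  by rewrite /cycle_adj /= -natr1 addrA eqxx.
by rewrite -(subrKC u v) -[v - u]natr_Zp.
Qed.

Lemma cycle_nonempty (n : nat) : (0 < #|'I_n.+2|)%N.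
Proof. by rewrite card_ord. Qed.

Definition cycle_network (n : nat) : network :=
  Network (@cycle_adj_sym n) (@cycle_adj_irrefl n) (@cycle_connected n)
          (cycle_nonempty n).

(* [v + u - r] for [u] between [0] and [2 r] runs over the nodes at distance at
   most [r] of [v] without any use of negative offsets. *)
Lemma dist_le_cycle (n r : nat) (v w : cycle_network n) :
  dist_le r v w <->
  exists2 u, (u <= r.*2)%N & w = (v : 'I_n.+2) + u%:R - r%:R.
Proof.
split=> [/dist_leP[p [sz pth <-]]|[u u_le ->]].
  elim: p v r sz pth {w} => [|x p IH] v r /= sz.
    by exists r; rewrite ?addrK //; lia.
  case: r sz => // r sz /andP[vx pth].
  have [u u_le ->] := IH x r sz pth.
  case/orP: vx => /eqP ->.
    by exists u.+2; [lia|rewrite -!(natr1 u.+1, natr1 u, natr1 r); ring].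
  by exists u; [lia|rewrite -natr1; ring].
apply/dist_leP; elim: r u u_le v {w} => [|r IH] u u_le v.
  exists [::]; split=> //=; have -> : u = 0%N by lia.
  by rewrite addrK.
(* The path steps backward for [u] at most 1 and forward otherwise, which leaves an offset allowed
   for radius [r]. For [u = 1] at radius 1 the target is [v] itself and the path is empty. *)
have [->|->|[u' u'_le ->]] : [\/ u = 0, u = 1 | exists2 u', (u' <= r.*2)%N & u = u'.+2]%N.
  case: u u_le => [|[|u]] u_le; [by constructor 1|by constructor 2|].
  by constructor 3; exists u; first by lia.
- have [p [sz pth lst]] := IH 0%N isT ((v : 'I_n.+2) - 1).
  exists ((v : 'I_n.+2) - 1 :: p); split=> //=.
    by rewrite /cycle_adj /= subrK eqxx orbT.
  by rewrite lst -natr1; ring.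
- case: r IH {u_le} => [|r] IH.
    by exists [::]; split=> //=; rewrite addrK.
  have [p [sz pth lst]] := IH 1%N isT ((v : 'I_n.+2) - 1).
  exists ((v : 'I_n.+2) - 1 :: p); split=> //=.
    by rewrite /cycle_adj /= subrK eqxx orbT.
  by rewrite lst -[r.+2%:R]natr1; ring.
- have [p [sz pth lst]] := IH u' u'_le ((v : 'I_n.+2) + 1).
  exists ((v : 'I_n.+2) + 1 :: p); split=> //=.
    by rewrite /cycle_adj /= eqxx.
  by rewrite lst -(natr1 u'.+1) -(natr1 u') -(natr1 r); ring.
Qed.

(* For [d = 2 r]: on a cycle of length at least [2 r + 2] the ball of radius [r] induces a
   path, so that the edges seen are exactly those between consecutive nodes of the
   window. *)
Lemma cycle_adj_window (n a k l d : nat) :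
  (k <= d)%N -> (l <= d)%N -> (d <= n)%N ->
  @cycle_adj n (a + k)%:R (a + l)%:R = (l == k.+1) || (k == l.+1).
Proof.
move=> kd ld dn.
have H i j : (i <= d)%N -> (j <= d)%N ->
    ((a + j)%:R == (a + i)%:R + 1 :> 'I_n.+2) = (j == i.+1).
  move=> id jd; rewrite natr1 -addnS -val_eqE /= !Zp_nat /= eqn_modDl !modn_small //; lia.
by rewrite /cycle_adj /= !H.
Qed.

Definition cycle_graph {n : nat} (inp : 'I_n.+2 -> nat) : labeled_graph :=
  @LabeledGraph (cycle_network n) inp.

Lemma cycle_view (r n a : nat) (inp id : 'I_n.+2 -> nat) (c : 'I_n.+2 -> bitseq) :
  (r.*2 <= n)%N ->
  let pos (u : 'I_r.*2.+1) : 'I_n.+2 := (a + u)%:R in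
  @local_view r (cycle_graph inp) id c ((a + r)%:R : 'I_n.+2) =
  View (id (a + r)%:R)
    [fset (id (pos u), inp (pos u), c (pos u)) | u in 'I_r.*2.+1]%fset
    [fset (id (pos e.1), id (pos e.2)) | e in [pred e : 'I_r.*2.+1 * 'I_r.*2.+1 |
       (e.2 == e.1.+1 :> nat) || (e.1 == e.2.+1 :> nat)]]%fset.
Proof.
move=> rn pos.
have E u : ((a + r)%:R : 'I_n.+2) + u%:R - r%:R = (a + u)%:R by rewrite !natrD; ring.
have B w : dist_le r ((a + r)%:R : cycle_network n) w <->
           exists u : 'I_r.*2.+1, w = pos u.
  split=> [/dist_le_cycle[u u_le ->]|[u ->]].
    by exists (Ordinal (u_le : (u < r.*2.+1)%N)); rewrite E.
  by apply/dist_le_cycle; exists (u : nat); rewrite ?E // -ltnS.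
rewrite /local_view; congr View.
  apply/fsetP => x; apply/imfsetP/imfsetP => [[w /= /B[u ->] ->]|[u _ ->]].
    by exists u.
  by exists (pos u) => //=; apply/B; exists u.
have adjE (u u' : 'I_r.*2.+1) : @adj (cycle_graph inp) (pos u) (pos u') =
    (u' == u.+1 :> nat) || (u == u'.+1 :> nat).
  by apply: (@cycle_adj_window n a u u' r.*2); rewrite // -ltnS.
apply/fsetP => x; apply/imfsetP/imfsetP => [[[w w']] /= ww' ->|].
  case/and3P: ww' => /= /B[u wE] /B[u' w'E] uu'; exists (u, u').
    by have := adjE u u'; rewrite -wE -w'E [LHS]uu' => /esym.
  by rewrite /= wE w'E.
move=> [[u u'] /= uu' ->]; exists (pos u, pos u') => //=; apply/and3P; split.
- by apply/B; exists u.
- by apply/B; exists u'.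
- by have := adjE u u'; rewrite [RHS]uu'.
Qed.

(** Here uniformity enters: once both cycles are longer than the window, a view does not reveal the
    length, so nodes of cycles of different lengths can be compared. *)
Lemma eq_cycle_accepts (A : verifier) (z : bitseq) (r n n' a a' : nat)
    (inp id : 'I_n.+2 -> nat) (c : 'I_n.+2 -> bitseq)
    (inp' id' : 'I_n'.+2 -> nat) (c' : 'I_n'.+2 -> bitseq) :
  (r.*2 <= n)%N -> (r.*2 <= n')%N ->
  (forall u, (u <= r.*2)%N ->
    [/\ id (a + u)%:R = id' (a' + u)%:R, inp (a + u)%:R = inp' (a' + u)%:R &
        c (a + u)%:R = c' (a' + u)%:R]) ->
  @accepts r A (cycle_graph inp) id c z ((a + r)%:R : 'I_n.+2) =
  @accepts r A (cycle_graph inp') id' c' z ((a' + r)%:R : 'I_n'.+2).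
Proof.
move=> rn rn' E; rewrite /accepts !cycle_view //; congr (A _ _).
have Eu (u : 'I_r.*2.+1) := E u (ltn_ord u : (u <= r.*2)%N).
congr View.
- by have [] := E r ltac:(lia).
- apply/fsetP => x; apply/imfsetP/imfsetP => -[u _ ->]; exists u => //;
  by have [-> -> ->] := Eu u.
- apply/fsetP => x; apply/imfsetP/imfsetP => -[[u u'] uu' ->]; exists (u, u') => //=;
  by have [-> _ _] := Eu u; have [-> _ _] := Eu u'.
Qed.

(** * Orders of blocks, and closing a segment of one into a cycle *)

(** Without descent [p] is increasing, so [i <= p i] everywhere; both sides have the same sum over
    [i], which forces equality. *)
Lemma perm_descent (m : nat) (p : {perm 'I_m}) :
  p != 1%g -> exists i j : 'I_m, j = i.+1 :> nat /\ (p j < p i)%N.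
Proof.
move=> p_neq1.
case: (boolP [exists i : 'I_m, exists j : 'I_m,
               (j == i.+1 :> nat) && (p j < p i)%N]).
  by move=> /existsP[i /existsP[j /andP[/eqP ij pji]]]; exists i, j.
move=> /existsPn H; case/eqP: p_neq1.
have le_p k (i : 'I_m) : i = k :> nat -> (i <= p i)%N.
  elim: k i => [|k IH] i ik; first by rewrite ik.
  have km : (k < m)%N by rewrite ltnW // -ik.
  have := IH (Ordinal km) erefl; move: (H (Ordinal km)).
  move=> /existsPn/(_ i); rewrite /= ik eqxx /= -leqNgt => le_pi le_k.
  have : p (Ordinal km) != p i by rewrite (inj_eq perm_inj) -val_eqE /= ik; lia.
  by rewrite -val_eqE /=; lia.
have /leqif_sum : forall i : 'I_m, true -> (i <= p i ?= iff (i == p i :> nat))%N.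
  by move=> i _; split=> //; apply: le_p.
move=> [_]; rewrite [X in _ == X](reindex_inj (@perm_inj _ p^-1)) /=.
under [X in _ == X]eq_bigr do rewrite permKV.
rewrite eqxx => /esym/forallP fix_p; apply/perm.permP => i; rewrite perm1.
by apply/val_inj/esym/eqP/(implyP (fix_p i)).
Qed.

(* Identifier of the node at position [k] of the cycle: the block of identifiers
   numbered [p i] is at the place [i], and the tail starts at [m.+1 * (2 r + 1)]. *)
Definition block_id (r m : nat) (p : {perm 'I_m.+1}) (k : nat) : nat :=
  if (k < m.+1 * r.*2.+1)%N
  then (p (inord (k %/ r.*2.+1)) * r.*2.+1 + k %% r.*2.+1).+1
  else k.+1.

Definition tail_input (r m : nat) (k : nat) : nat := (m.+1 * r.*2.+1 <= k)%N.

Lemma block_idE (r m : nat) (p : {perm 'I_m.+1}) (i : 'I_m.+1) (t : nat) :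
  (t < r.*2.+1)%N -> block_id r m p (i * r.*2.+1 + t) = (p i * r.*2.+1 + t).+1.
Proof.
move=> tL; rewrite /block_id.
have -> : (i * r.*2.+1 + t < m.+1 * r.*2.+1)%N.
  apply: (@leq_trans (i.+1 * r.*2.+1)); first by rewrite mulSn addnC ltn_add2r.
  by rewrite leq_mul2r ltn_ord orbT.
by rewrite divnMDl // (divn_small tL) addn0 modnMDl (modn_small tL) inord_val.
Qed.

Lemma block_id_le (r m : nat) (p : {perm 'I_m.+1}) (k : nat) :
  (k < m.+1 * r.*2.+1)%N -> (block_id r m p k <= m.+1 * r.*2.+1)%N.
Proof.
rewrite /block_id => k_lt; rewrite k_lt.
apply: (@leq_trans ((p (inord (k %/ r.*2.+1))).+1 * r.*2.+1)).
  by rewrite mulSn addnC ltn_add2r ltn_mod.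
by rewrite leq_mul2r ltn_ord orbT.
Qed.

Lemma block_id_inj (r m : nat) (p : {perm 'I_m.+1}) : injective (block_id r m p).
Proof.
move=> k k'; have := @block_id_le r m p k; have := @block_id_le r m p k'.
rewrite /block_id; case: (ltnP k) => kL; case: (ltnP k') => kL' /=; last first.
- by move=> _ _ [].
- by move=> /(_ isT) + _; lia.
- by move=> _ /(_ isT); lia.
move=> _ _ [] E; set L := r.*2.+1 in kL kL' E *.
have := congr1 (divn^~ L) E; have := congr1 (modn^~ L) E.
rewrite !modnMDl !modn_mod !divnMDl // !(divn_small (ltn_pmod _ _)) // !addn0.
move=> modE /val_inj/perm_inj/(congr1 val); rewrite /= !inordK ?ltn_divLR //.
by move=> divE; rewrite (divn_eq k L) (divn_eq k' L) divE modE.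
Qed.

Lemma val_natr (n k : nat) : (k%:R : 'I_n.+2) = (k %% n.+2)%N :> nat.
Proof. by rewrite Zp_nat. Qed.

Definition block_graph (r m n : nat) : labeled_graph :=
  @cycle_graph n (fun v => tail_input r m v).

Definition block_graph_id (r m n : nat) (p : {perm 'I_m.+1}) (v : 'I_n.+2) : nat :=
  block_id r m p v.

(* A pair of blocks consecutive in the order [s], but not in this order in [p],
   closes the segment of [p] between them into a cycle of unselected nodes, each
   of which has a view occurring in one of the two accepted instances. *)
Lemma accepted_block_orders_eq (r m n : nat) (A : verifier) (p s : {perm 'I_m.+1})
    (cp cs : 'I_n.+2 -> bitseq) (z : bitseq) :
  (1 <= r)%N -> (m.+1 * r.*2.+1 <= n.+2)%N -> (r.*2 <= n)%N ->
  sound_scheme ALOS r A ->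
  (forall v, @accepts r A (block_graph r m n) (block_graph_id r m n p) cp z v) ->
  (forall v, @accepts r A (block_graph r m n) (block_graph_id r m n s) cs z v) ->
  (forall (i : 'I_m.+1) t, (t < r.*2.+1)%N ->
     cp (p^-1%g i * r.*2.+1 + t)%:R = cs (s^-1%g i * r.*2.+1 + t)%:R) ->
  p = s.
Proof.
move=> r_gt0 mn rn sound acc_p acc_s eqc; apply/eqP/negPn/negP => neq_ps.
(* [s * p^-1] sends a place in the order [s] to the place in the order [p] of the block found
   there. *)
have [i [i' [i'E lt_ii']]] : exists i i' : 'I_m.+1,
    i' = i.+1 :> nat /\ (p^-1%g (s i') < p^-1%g (s i))%N.
  have [|i [i' []]] := @perm_descent _ (s * p^-1)%g.
    by apply: contra neq_ps => /eqP/(canRL (mulgKV _)); rewrite mul1g => ->.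
  by rewrite !permM => ? ?; exists i, i'.
set L := r.*2.+1 in mn eqc *.
set i0 := p^-1%g (s i') in lt_ii'; set i1 := p^-1%g (s i) in lt_ii'.
have pi0 : p i0 = s i' by rewrite permKV.
have pi1 : p i1 = s i by rewrite permKV.
have i1m : (i1 <= m)%N by rewrite -ltnS.
have [d [i1E d_gt0]] : exists d, i1 = (i0 + d)%N :> nat /\ (0 < d)%N.
  by exists (i1 - i0)%N; lia.
have L_ge2 : (2 <= L)%N by rewrite /L; lia.
have dL_ge : (L <= d * L)%N by rewrite leq_pmull.
(* The new cycle consists of the [d + 1] blocks at the places [i0] to [i1] of [p]. As [d > 0] it is
   long enough for a window not to meet itself. *)
have [n' n'E] : exists n', n'.+2 = (d.+1 * L)%N.
  by exists (d.+1 * L - 2)%N; rewrite mulSn; lia.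
have i1L : (i1.+1 * L <= m.+1 * L)%N by rewrite leq_mul2r ltnS i1m orbT.
have segn (k : nat) : (k < n'.+2)%N -> (i0 * L + k < m.+1 * L)%N.
  by rewrite n'E; move: i1L; rewrite i1E -addnS mulnDl; lia.
pose id' (v : 'I_n'.+2) := block_id r m p (i0 * L + v).
pose c' (v : 'I_n'.+2) := cp (i0 * L + v)%:R.
have [] := @sound (@cycle_graph n' (fun=> 0%N)) id' _ _ c' z.
- by case.
- split=> [v w /block_id_inj/addnI/val_inj//|v].
  by rewrite /id' /block_id; case: ifP.
move=> v /negP; apply.
have rn' : (r.*2 <= n')%N.
  by move: n'E dL_ge; rewrite mulSn /L; lia.
(* The window of [v] starts at [v - r] modulo the length; adding [n'.+2] first avoids truncated
   subtraction. *)
pose a := ((v + n'.+2 - r) %% n'.+2)%N.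
have a_lt : (a < n'.+2)%N by rewrite ltn_mod.
have vE : v = (a + r)%:R :> 'I_n'.+2.
  apply/val_inj; rewrite /= val_natr /a modnDml subnK; last by lia.
  by rewrite modnDr modn_small.
rewrite vE.
(* A window that does not wrap around already occurs in the instance of [p]. *)
have [a_in|a_last] := leqP (a + r.*2.+1) n'.+2.
  rewrite (@eq_cycle_accepts A z r n' n a (i0 * L + a) (fun=> 0%N) id' c'
    (fun v => tail_input r m v) (block_graph_id r m n p) cp) //.
  move=> u u_le; rewrite /id' /c' /block_graph_id !val_natr -addnA.
  have au_lt : (i0 * L + (a + u) < m.+1 * L)%N by apply: segn; lia.
  rewrite !modn_small; [|exact: leq_trans mn|lia].
  by split; rewrite // /tail_input leqNgt au_lt.
(* A wrapping window starts in the last block, [s i], and ends in the first, [s i']: it is the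
   window of the instance of [s] that starts at offset [t] of place [i]. *)
have [t [aE t_lt]] : exists t, a = (d * L + t)%N /\ (t < L)%N.
  by exists (a - d * L)%N; move: a_last a_lt; rewrite n'E mulSn -/L; lia.
rewrite (@eq_cycle_accepts A z r n' n a (i * L + t) (fun=> 0%N) id' c'
  (fun v => tail_input r m v) (block_graph_id r m n s) cs) //.
move=> u u_le; rewrite /id' /c' /block_graph_id !val_natr.
have iu_lt : (i * L + t + u < m.+1 * L)%N.
  apply: (@leq_trans (i.+2 * L)); first by rewrite !mulSn /L; lia.
  by rewrite leq_mul2r -i'E ltn_ord orbT.
rewrite (modn_small (leq_trans iu_lt mn)) /tail_input leqNgt iu_lt.
have [tu_lt|tu_ge] := ltnP (t + u) L.
  rewrite modn_small; last by rewrite aE n'E mulSn; lia.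
  have -> : (i0 * L + (a + u) = i1 * L + (t + u))%N by rewrite aE i1E mulnDl; lia.
  rewrite -[(i * L + t + u)%N]addnA !block_idE // pi1; split=> //.
  by rewrite eqc // permK.
have auE : ((a + u) = (t + u - L) + n'.+2)%N by rewrite aE n'E mulSn; lia.
have tuL : (t + u - L < L)%N by rewrite /L; lia.
rewrite auE modnDr modn_small; last by rewrite n'E mulSn; lia.
have -> : (i * L + t + u = i' * L + (t + u - L))%N by rewrite i'E mulSn; lia.
rewrite !block_idE // pi0; split=> //.
by rewrite eqc // permK.
Qed.

(** * Counting orders by their certificates *)

(* The final [true] before the padding marks the length of the string. *)
Definition pad_bits (k : nat) (s : bitseq) : k.+1.-tuple bool :=
  [tuple nth false (rcons s true) i | i < k.+1].

Lemma pad_bits_inj (k : nat) (s s' : bitseq) :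
  (size s <= k)%N -> (size s' <= k)%N -> pad_bits k s = pad_bits k s' -> s = s'.
Proof.
move=> sk s'k E.
have eq_nth i : (i < k.+1)%N -> nth false (rcons s true) i = nth false (rcons s' true) i.
  move=> ik; have /(congr1 (fun t => tnth t (Ordinal ik))) := E.
  by rewrite !tnth_mktuple.
have eq_sz : size s = size s'.
  have [lt|lt|//] := ltngtP (size s) (size s').
    have := eq_nth (size s') s'k.
    by rewrite [RHS]nth_rcons ltnn eqxx nth_default // size_rcons.
  have := eq_nth (size s) sk.
  by rewrite [LHS]nth_rcons ltnn eqxx nth_default // size_rcons.
apply: (@rcons_injl _ true); apply: (@eq_from_nth _ false) => [|i].
  by rewrite !size_rcons eq_sz.
by rewrite size_rcons => i_lt; apply: eq_nth; apply: leq_trans i_lt _.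
Qed.

Lemma block_graph_id_in_range (R : realType) (kappa : R) (r m n : nat)
    (p : {perm 'I_m.+1}) :
  1 <= kappa -> (m.+1 * r.*2.+1 <= n.+2)%N ->
  @identifiers_in_range R kappa (block_graph r m n) (block_graph_id r m n p).
Proof.
move=> kappa_ge1 mn v; rewrite card_ord; apply: (@le_trans _ _ n.+2%:R).
  rewrite ler_nat /block_graph_id.
  have [v_lt|v_ge] := ltnP v (m.+1 * r.*2.+1).
    exact: leq_trans (block_id_le _ _ _ _ v_lt) mn.
  by rewrite /block_id ltnNge v_ge ltn_ord.
by rewrite -[leLHS]powRr1 // ler_powR // ler1n.
Qed.

Lemma block_graph_id_assignment (r m n : nat) (p : {perm 'I_m.+1}) :
  @identifier_assignment (block_graph r m n) (block_graph_id r m n p).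
Proof.
split=> [v w /block_id_inj/val_inj //|v].
by rewrite /block_graph_id /block_id; case: ifP.
Qed.

Lemma block_graph_ALOS (r m n : nat) :
  (m.+1 * r.*2.+1 < n.+2)%N -> ALOS (block_graph r m n).
Proof. by move=> mn; exists (Ordinal mn); rewrite /selected /= /tail_input leqnn. Qed.

(** Each order is coded by its global certificate and the local certificates of its blocks, listed
    by block number and offset instead of by position. Equal codes thus meet the hypotheses of
    [accepted_block_orders_eq]. *)
Lemma fact_le_certificates (R : realType) (kappa : R) (r : nat) (A : verifier)
    (f g : nat -> nat) (m n : nat) :
  1 <= kappa -> (1 <= r)%N -> correct_scheme kappa ALOS r A f g ->
  (m.+1 * r.*2.+1 < n.+2)%N -> (r.*2 <= n)%N ->
  (m.+1`! <= 2 ^ ((g n.+2).+1 + (f n.+2).+1 * n.+2))%N.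
Proof.
move=> kappa_ge1 r_gt0 [compl sound] mn rn.
have /fin_all_exists[c /fin_all_exists[z H]] : forall p : {perm 'I_m.+1},
    exists (c : 'I_n.+2 -> bitseq) (z : bitseq),
    [/\ forall v, (size (c v) <= f n.+2)%N, (size z <= g n.+2)%N &
        forall v, @accepts r A (block_graph r m n) (block_graph_id r m n p) c z v].
  move=> p; have := compl _ _ (block_graph_ALOS _ _ _ mn)
    (block_graph_id_assignment r m n p)
    (block_graph_id_in_range _ _ _ _ _ p kappa_ge1 (ltnW mn)).
  by rewrite card_ord.
pose code (p : {perm 'I_m.+1}) :=
  (pad_bits (g n.+2) (z p),
   [ffun it : 'I_m.+1 * 'I_r.*2.+1 =>
      pad_bits (f n.+2) (c p (p^-1%g it.1 * r.*2.+1 + it.2)%:R)]).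
have code_inj : injective code.
  move=> p s eq_code; have eq_z := congr1 fst eq_code; have eq_c := congr1 snd eq_code.
  have [size_cp size_zp acc_p] := H p; have [size_cs size_zs acc_s] := H s.
  rewrite (pad_bits_inj _ _ _ size_zp size_zs eq_z) in acc_p.
  apply: accepted_block_orders_eq (ltnW mn) rn sound acc_p acc_s _ => // i t t_lt.
  move/ffunP/(_ (i, Ordinal t_lt)): eq_c; rewrite !ffunE /=.
  exact: pad_bits_inj.
have := leq_card _ code_inj.
rewrite card_Sn card_prod card_tuple card_ffun card_prod !card_ord card_tuple card_bool.
rewrite -expnM -expnD => /leq_trans; apply.
by rewrite leq_pexp2l // leq_add2l leq_mul2l (ltnW mn) orbT.
Qed.

(** * From the factorial to the bound on the size *)

Lemma expn_le_fact_double (h : nat) : (h ^ h <= h.*2`!)%N.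
Proof.
have H k : (h ^ k <= (h + k)`!)%N.
  elim: k => [|k IH]; first by rewrite fact_gt0.
  by rewrite expnS addnS factS leq_mul // ltnW // ltnS leq_addr.
by rewrite -addnn H.
Qed.

(** This is the bound in exponential form, free of logarithms. The threshold on [n] gives
    [2 ^ (32 * r.*2.+1 * n) <= n ^ n]. *)
Lemma expn_le_mixed_proof_size (R : realType) (kappa : R) (r : nat) (A : verifier)
    (f g : nat -> nat) (n : nat) :
  1 <= kappa -> (1 <= r)%N -> correct_scheme kappa ALOS r A f g ->
  (2 ^ (32 * r.*2.+1) <= n)%N ->
  (n ^ n <= 2 ^ (16 * r.*2.+1 * mixed_proof_size f g n))%N.
Proof.
move=> kappa_ge1 r_gt0 scheme; set L := r.*2.+1; set S := mixed_proof_size f g n => n_ge.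
have n_gt : (8 * L * L < n)%N.
  apply: leq_trans n_ge; apply: (@leq_trans (2 ^ (3 + L + L))).
    rewrite !expnD; have := ltn_expl L (isT : (1 < 2)%N); nia.
  by rewrite leq_exp2l //; rewrite /L; lia.
(* With [2 h] blocks of length [L], at least one node remains for the selected tail, and
   [n <= 4 * L * h]. *)
pose h := (n.-1 %/ L.*2)%N.
have L_gt0 : (0 < L)%N by [].
have h_ge : (4 * L <= h)%N by rewrite leq_divRL ?double_gt0 //; nia.
have hn : (h.*2 * L < n)%N.
  have := leq_divM n.-1 L.*2; rewrite -/h; nia.
have nh : (n <= 4 * L * h)%N.
  have := ltn_ceil n.-1 (isT : (0 < L.*2)%N); rewrite -/h; nia.
have [m mE] : exists m, m.+1 = h.*2 by exists h.*2.-1; lia.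
have [n' n'E] : exists n', n = n'.+2 by exists n.-2; lia.
(* The marker bits of the padded certificates add [n + 1 <= 2 n] to the exponent. *)
have fact_le : (h.*2`! <= 2 ^ (S + n.*2))%N.
  rewrite -mE; apply: (@leq_trans (2 ^ ((g n).+1 + (f n).+1 * n))).
    rewrite n'E; apply: fact_le_certificates kappa_ge1 r_gt0 scheme _ _.
      by rewrite mE -n'E.
    by rewrite /L in n_gt; nia.
  by rewrite leq_exp2l // /S /mixed_proof_size; nia.
have : (n ^ n <= 2 ^ (8 * L * (S + n.*2)))%N.
  (* As [4 * L <= h], [n <= 4 * L * h <= h ^ 2], hence [n ^ n <= h ^ (2 n) <= h ^ (8 * L * h)]. *)
  apply: (@leq_trans ((h ^ h) ^ (8 * L))).
    rewrite -expnM; apply: (@leq_trans ((h ^ 2) ^ n)).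
      by rewrite leq_exp2r; [rewrite -mulnn; nia|lia].
    by rewrite -expnM leq_exp2l; [nia|lia].
  rewrite [X in (_ <= 2 ^ X)%N]mulnC [X in (_ <= X)%N]expnM leq_exp2r //.
  exact: leq_trans (expn_le_fact_double h) fact_le.
(* Squaring leaves a spare factor [n ^ n], which absorbs the terms linear in [n]
   of the exponent. *)
rewrite -leq_sqr -[X in (_ <= X)%N]expnM.
rewrite [(8 * L * _ * 2)%N](_ : _ = 16 * L * S + 32 * L * n)%N; last by lia.
rewrite expnD -mulnn => le_sqr.
have : (n ^ n * n ^ n <= 2 ^ (16 * L * S) * n ^ n)%N.
  apply: leq_trans le_sqr _; rewrite leq_mul2l [(2 ^ (32 * L * n))%N]expnM.
  by rewrite leq_exp2r ?n_ge ?orbT //; lia.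
by rewrite leq_pmul2r // expn_gt0; apply/orP; left; lia.
Qed.

Theorem theorem5 (R : realType) (kappa : R) (r : nat) (A : verifier)
    (f g : nat -> nat) :
  1 <= kappa ->
  (1 <= r)%N ->
  correct_scheme kappa ALOS r A f g ->
  (fun n : nat => (mixed_proof_size f g n)%:R : R)
    \is 'Omega_\oo (fun n : nat => n%:R * ln n%:R : R).
Proof.
move=> kappa_ge1 r_gt0 scheme; pose C := (16 * r.*2.+1)%N.
rewrite qualifE /=; apply/boolp.asboolP; exists (C%:R^-1 : R).
  by rewrite invr_gt0 ltr0n.
exists (2 ^ (32 * r.*2.+1))%N => // n /= n_ge.
have n_gt0 : (0 < n)%N by apply: leq_trans n_ge; rewrite expn_gt0.
have ln_ge0 : 0 <= ln (n%:R : R) by rewrite ln_ge0 // ler1n.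
rewrite ger0_norm ?mulr_ge0 // ger0_norm // ler_pdivrMl ?ltr0n //.
have := expn_le_mixed_proof_size _ _ _ _ _ _ _ kappa_ge1 r_gt0 scheme n_ge.
rewrite -(ler_nat R) !natrX -ler_ln ?posrE ?exprn_gt0 ?ltr0n // !lnXn ?ltr0n //.
rewrite -[X in X <= _ -> _]mulr_natl -[X in _ <= X -> _]mulr_natl -natrM.
move=> /le_trans; apply.
(* The remaining factor [ln 2] is at most 1, by [ln (1 + x) <= x]. *)
rewrite ler_piMr // -[2]/(1 + 1).
by apply: le_ln1Dx; rewrite (lt_trans _ ltr01) // ltrN10.
Qed.
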